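(* Let $\bar M$ be a Kaehler manifold. Then there exist no non-trivial warped product submanifolds $M=M_\theta\times_f M_T$ of $\bar M$ such that $M_T$ is a holomorphic submanifold of $\bar M$ and $M_\theta$ is a proper pointwise slant submanifold of $\bar M$.
   Context: All objects are smooth. A Kaehler manifold $(\bar M,g,J)$ is a Riemannian manifold with a $(1,1)$-tensor field $J$ such that $J^2=-I$, $g(JX,JY)=g(X,Y)$ and $\bar\nabla J=0$, where $\bar\nabla$ is the Levi-Civita connection of $\bar M$. A submanifold $N$ of $\bar M$ is holomorphic if $J(T_pN)\subset T_pN$ for all $p\in N$. It is pointwise slant if at each $p\in N$ the angle $\theta(X)$ between $JX$ and $T_pN$ is the same for all nonzero $X\in T_pN$; the resulting function $\theta$ on $N$ is the slant function. A pointwise slant submanifold is proper if it contains no totally real points, i.e. $\cos\theta\neq 0$ at every point. For Riemannian manifolds $(B,g_1)$, $(F,g_2)$ and $f:B\to(0,\infty)$, the warped product $B\times_f F$ is the manifold $B\times F$ with metric $\pi^*g_1+(f\circ\pi)^2\eta^*g_2$, where $\pi,\eta$ are the projections onto $B$ and $F$; $f$ is called the warping function. The warped product is trivial if $f$ is constant, and non-trivial otherwise. A warped product submanifold $M=M_\theta\times_f M_T$ of $\bar M$ is a warped product with base $M_\theta$ and fibre $M_T$ that is isometrically immersed in $\bar M$.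
   Formalization: The formal theorem assumes M_θ connected and M_T nonempty of positive dimension; without these the claim fails (a locally constant non-constant f on a disconnected base, or an arbitrary f with an empty or 0-dimensional fibre). *)

(* Defs.v *)
From HB Require Import structures.
From mathcomp Require Import all_boot all_order all_algebra.
From mathcomp Require Import all_classical all_reals all_analysis.

Set Implicit Arguments.
Unset Strict Implicit.
Unset Printing Implicit Defensive.

Import Order.TTheory GRing.Theory Num.Theory.
Import numFieldNormedType.Exports.

Local Open Scope classical_set_scope.
Local Open Scope ring_scope.

Definition iter_derive (R : realType) (V W : normedModType R)
    (f : V -> W) (vs : seq V) : V -> W :=
  foldr (fun v (h : V -> W) => 'D_v h) f vs.

(* C^oo on U: all iterated directional derivatives exist and are (Frechet)
   differentiable at every point of U.  Only used for open U. *)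
Definition smooth_on (R : realType) (V W : normedModType R)
    (U : set V) (f : V -> W) : Prop :=
  forall vs x, U x -> differentiable (iter_derive f vs) x.

Section SmoothTheory.
Context {R : realType}.
Implicit Types V W : normedModType R.

Lemma near_eq_differentiable V W (f g : V -> W) (x : V) :
  (\near x, f x = g x) -> differentiable f x -> differentiable g x.
Proof.
move=> fg dfx; have [cdf ef] := (diff_locallyP x f).1 dfx.
have eg : g \o shift x = cst (g x) + 'd f x +o_0 id.
  apply/eqaddoP => _/posnumP[e].
  have /eqaddoP/(_ e%:num (gt0 e)) := ef.
  have fg0 : \forall h \near 0, f (h + x) = g (h + x).
    by have := fg; rewrite (near_shift 0) subr0.
  have fgx : f x = g x by exact: nbhs_singleton fg.
  move=> H; near=> h; have -> : (g \o shift x - (cst (g x) + 'd f x)) h =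
     (f \o shift x - (cst (f x) + 'd f x)) h.
    rewrite !fctE /= fgx; congr (_ - _); apply/esym; near: h; exact: fg0.
  by near: h.
apply/diff_locallyP; have -> : 'd g x = 'd f x :> (V -> W) by exact: diff_unique.
by split.
Unshelve. all: by end_near. Qed.

Lemma iter_derive_rcons V W (f : V -> W) vs v :
  iter_derive f (rcons vs v) = iter_derive ('D_v f) vs.
Proof. by rewrite /iter_derive foldr_rcons. Qed.

Lemma iter_derive_ext V W (U : set V) (f g : V -> W) vs :
  open U -> (forall x, U x -> f x = g x) ->
  forall x, U x -> iter_derive f vs x = iter_derive g vs x.
Proof.
move=> oU fg; elim: vs => [|v vs IH] x Ux; first exact: fg.
apply: near_eq_derive; apply: filterS (open_nbhs_nbhs (conj oU Ux)) => y; exact: IH.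
Qed.

Definition smooth_upto V W k (U : set V) (f : V -> W) :=
  forall vs x, (size vs <= k)%N -> U x -> differentiable (iter_derive f vs) x.

Lemma smooth_uptoP V W (U : set V) (f : V -> W) :
  smooth_on U f <-> forall k, smooth_upto k U f.
Proof. by split=> [h k vs x _|h vs x]; [exact: h|exact: (h (size vs))]. Qed.

Lemma smooth_upto_ext V W k (U : set V) (f g : V -> W) :
  open U -> (forall x, U x -> f x = g x) ->
  smooth_upto k U f -> smooth_upto k U g.
Proof.
move=> oU fg sf vs x svs Ux; apply: near_eq_differentiable (sf vs x svs Ux).
apply: filterS (open_nbhs_nbhs (conj oU Ux)) => y; exact: iter_derive_ext.
Qed.

Lemma smooth_on_ext V W (U : set V) (f g : V -> W) :
  open U -> (forall x, U x -> f x = g x) -> smooth_on U f -> smooth_on U g.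
Proof. by move=> oU fg /smooth_uptoP sf; apply/smooth_uptoP => k; exact: smooth_upto_ext (sf k). Qed.

Lemma smooth_on_sub V W (A B : set V) (f : V -> W) :
  A `<=` B -> smooth_on B f -> smooth_on A f.
Proof. by move=> AB sf vs x /AB; exact: sf. Qed.

Lemma smooth_on_derive V W (U : set V) (f : V -> W) v :
  smooth_on U f -> smooth_on U ('D_v f).
Proof. by move=> sf vs x Ux; rewrite -iter_derive_rcons; exact: sf. Qed.

Lemma smooth_on_differentiable V W (U : set V) (f : V -> W) x :
  smooth_on U f -> U x -> differentiable f x.
Proof. by move=> sf; exact: (sf [::]). Qed.

Lemma smooth_uptoS V W k (U : set V) (f : V -> W) :
  (forall x, U x -> differentiable f x) ->
  (forall v, smooth_upto k U ('D_v f)) -> smooth_upto k.+1 U f.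
Proof.
move=> df sf vs x; case/lastP: vs => [|vs v]; first by move=> _; exact: df.
by rewrite size_rcons iter_derive_rcons ltnS; exact: sf.
Qed.

Lemma smooth_uptoD V W k (U : set V) (f g : V -> W) : open U ->
  smooth_upto k U f -> smooth_upto k U g -> smooth_upto k U (fun x => f x + g x).
Proof.
move=> oU sf sg.
have E vs : (size vs <= k.+1)%N -> forall x, U x ->
    iter_derive (fun x => f x + g x) vs x =
    iter_derive f vs x + iter_derive g vs x.
  elim: vs => [//|v vs IH] svs x Ux; have svs' : (size vs <= k)%N by [].
  transitivity ('D_v (iter_derive f vs \+ iter_derive g vs) x).
    apply: near_eq_derive; apply: filterS (open_nbhs_nbhs (conj oU Ux)) => y.
    by apply: IH; exact: ltnW.
  by rewrite deriveD //; apply: diff_derivable; [exact: sf|exact: sg].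
move=> vs x svs Ux.
apply: (@near_eq_differentiable _ _ (iter_derive f vs \+ iter_derive g vs)).
  apply: filterS (open_nbhs_nbhs (conj oU Ux)) => y Uy /=.
  by rewrite E //; exact: leqW.
by apply: differentiableD; [exact: sf|exact: sg].
Qed.

Lemma smooth_onM V (U : set V) (f g : V -> R) : open U ->
  smooth_on U f -> smooth_on U g -> smooth_on U (fun x => f x * g x).
Proof.
move=> oU sf sg; apply/smooth_uptoP => k; elim: k f g sf sg => [|k IH] f g sf sg.
  move=> [|//] x _ Ux; apply: differentiableM.
    exact: smooth_on_differentiable Ux.
  exact: smooth_on_differentiable Ux.
apply: smooth_uptoS => [x Ux|v].
  apply: differentiableM; exact: smooth_on_differentiable Ux.
apply: (@smooth_upto_ext _ _ _ _ (fun x => f x * 'D_v g x + g x * 'D_v f x)) => //.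
  move=> x Ux; rewrite (@deriveM _ _ f g) //; apply: diff_derivable;
    exact: smooth_on_differentiable Ux.
by apply: smooth_uptoD => //; apply: IH => //; exact: smooth_on_derive.
Qed.

Lemma derive_lin_comp V W W' (L : {linear W -> W'}) (f : V -> W) (v x : V) :
  continuous L -> differentiable f x -> 'D_v (L \o f) x = L ('D_v f x).
Proof.
move=> cL df; rewrite !deriveE //; last first.
  by apply: differentiable_comp => //; exact: linear_differentiable.
by rewrite diff_comp ?diff_lin //; exact: linear_differentiable.
Qed.

Lemma smooth_on_lin V W W' (U : set V) (L : {linear W -> W'}) (f : V -> W) :
  open U -> continuous L -> smooth_on U f -> smooth_on U (L \o f).
Proof.
move=> oU cL sf.
have E vs x : U x -> iter_derive (L \o f) vs x = L (iter_derive f vs x).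
  elim: vs x => [//|v vs IH] x Ux.
  transitivity ('D_v (L \o iter_derive f vs) x).
    by apply: near_eq_derive; apply: filterS (open_nbhs_nbhs (conj oU Ux)) => y; exact: IH.
  by rewrite derive_lin_comp //; exact: sf.
move=> vs x Ux; apply: (@near_eq_differentiable _ _ (L \o iter_derive f vs)).
  by apply: filterS (open_nbhs_nbhs (conj oU Ux)) => y Uy; rewrite E.
apply: differentiable_comp; [exact: sf|exact: linear_differentiable].
Qed.

Lemma derive_comp_lin V V' W (L : {linear V -> V'}) (f : V' -> W) (v x : V) :
  continuous L -> differentiable f (L x) ->
  'D_v (f \o L) x = 'D_(L v) f (L x).
Proof.
move=> cL df; rewrite !deriveE //; last first.
  by apply: differentiable_comp => //; exact: linear_differentiable.
by rewrite diff_comp ?diff_lin //; exact: linear_differentiable.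
Qed.

Lemma smooth_on_comp_lin V V' W (U : set V') (L : {linear V -> V'})
  (f : V' -> W) : open U ->
  continuous L -> smooth_on U f -> smooth_on (L @^-1` U) (f \o L).
Proof.
move=> oU cL sf; have oLU : open (L @^-1` U) by apply: open_comp => // + _.
have E vs x : U (L x) ->
    iter_derive (f \o L) vs x = iter_derive f (map L vs) (L x).
  elim: vs x => [//|v vs IH] x Ux.
  transitivity ('D_v (iter_derive f (map L vs) \o L) x).
    apply: near_eq_derive; apply: filterS (open_nbhs_nbhs (conj oLU Ux)) => y; exact: IH.
  by rewrite derive_comp_lin //; exact: sf.
move=> vs x Ux; apply: (@near_eq_differentiable _ _ (iter_derive f (map L vs) \o L)).
  by apply: filterS (open_nbhs_nbhs (conj oLU Ux)) => y Uy; rewrite E.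
apply: differentiable_comp; [exact: linear_differentiable|exact: sf].
Qed.

Definition coord_lin m n (i : 'I_m) (j : 'I_n) (A : 'M[R]_(m, n)) : R := A i j.

Lemma coord_lin_is_linear m n (i : 'I_m) (j : 'I_n) : linear (@coord_lin m n i j).
Proof. by move=> a u v; rewrite /coord_lin !mxE. Qed.

HB.instance Definition _ m n (i : 'I_m) (j : 'I_n) :=
  GRing.isLinear.Build R 'M[R]_(m, n) R _ (@coord_lin m n i j)
    (@coord_lin_is_linear m n i j).

Lemma derive_coord V m n (f : V -> 'M[R]_(m, n)) (v x : V) i j :
  differentiable f x -> 'D_v (fun y => f y i j) x = 'D_v f x i j.
Proof.
by move=> df; apply: (@derive_lin_comp _ _ _ (@coord_lin m n i j)) => //; exact: coord_continuous.
Qed.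

Lemma differentiable_mx V m n (f : V -> 'M[R]_(m, n)) (x : V) :
  (forall i j, differentiable (fun y => f y i j) x) -> differentiable f x.
Proof.
move=> df; have -> : f = \sum_i \sum_j (fun y => f y i j *: delta_mx i j).
  apply/funext => y; rewrite {1}[f y]matrix_sum_delta fct_sumE.
  by apply: eq_bigr => i _; rewrite fct_sumE.
by apply: differentiable_sum => i; apply: differentiable_sum => j; exact: differentiableZl.
Qed.

Lemma smooth_mxP V m n (U : set V) (f : V -> 'M[R]_(m, n)) : open U ->
  smooth_on U f <-> forall i j, smooth_on U (fun x => f x i j).
Proof.
move=> oU; split=> [sf i j|sf].
  by apply: (@smooth_on_lin _ _ _ _ (@coord_lin m n i j)) => //; exact: coord_continuous.
have E vs x i j : U x ->
    iter_derive f vs x i j = iter_derive (fun x => f x i j) vs x.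
  elim: vs x i j => [//|v vs IH] x i j Ux.
  transitivity ('D_v (fun y => iter_derive f vs y i j) x).
    rewrite derive_coord //; apply: differentiable_mx => a b.
    apply: near_eq_differentiable (sf a b vs x Ux).
    by apply: filterS (open_nbhs_nbhs (conj oU Ux)) => y Uy /=; rewrite IH.
  by apply: near_eq_derive; apply: filterS (open_nbhs_nbhs (conj oU Ux)) => y; exact: IH.
move=> vs x Ux; apply: differentiable_mx => i j.
apply: near_eq_differentiable (sf i j vs x Ux).
by apply: filterS (open_nbhs_nbhs (conj oU Ux)) => y Uy /=; rewrite E.
Qed.

Lemma smooth_on_cst V W (U : set V) (c : W) : smooth_on U (fun _ => c).
Proof.
have E vs : exists d : W, iter_derive (fun _ : V => c) vs = cst d.
  elim: vs => [|v vs [d dE]]; first by exists c.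
  by exists 0; rewrite /= dE; apply/funext => x; rewrite derive_cst.
by move=> vs x _; have [d ->] := E vs; exact: differentiable_cst.
Qed.

End SmoothTheory.

(* A smooth manifold of dimension n: a second countable Hausdorff space with a
   smooth atlas.  The charts are indexed by [atlas]; the chart i is
   cmap i : cdom i -> R^n, with inverse cinv i : cmap i @` cdom i -> cdom i. *)
Record manifold (R : realType) (n : nat) := Manifold {
  mspace :> topologicalType;
  atlas : Type;
  cdom : atlas -> set mspace;
  cmap : atlas -> mspace -> 'rV[R]_n;
  cinv : atlas -> 'rV[R]_n -> mspace;
  mspace_hausdorff : hausdorff_space mspace;
  mspace_second_countable : @second_countable mspace;
  cdom_open : forall i, open (cdom i);
  cdom_cover : forall p, exists i, cdom i p;
  cimg_open : forall i, open (cmap i @` cdom i);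
  cmapK : forall i p, cdom i p -> cinv i (cmap i p) = p;
  cmap_continuous : forall i p, cdom i p -> {for p, continuous (cmap i)};
  cinv_continuous : forall i x, (cmap i @` cdom i) x ->
    {for x, continuous (cinv i)};
  transition_smooth : forall i j,
    smooth_on (cmap i @` (cdom i `&` cdom j)) (cmap j \o cinv i)
}.

Arguments atlas {R n} m.
Arguments cdom {R n} m.
Arguments cmap {R n} m.
Arguments cinv {R n} m.

Section SmoothMaps.
Context {R : realType}.

(* A family h of local data, one function on cdom i for each chart i. *)
Definition smooth_family n (M : manifold R n) (W : normedModType R)
    (h : atlas M -> M -> W) : Prop :=
  forall i, smooth_on (cmap M i @` cdom M i) (h i \o cinv M i).

Definition smooth_fun n (M : manifold R n) (f : M -> R) : Prop :=
  smooth_family (fun _ : atlas M => f).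

Definition smooth_map m n (N : manifold R m) (M : manifold R n)
    (phi : N -> M) : Prop :=
  continuous phi /\
  forall i j, smooth_on (cmap N i @` (cdom N i `&` phi @^-1` cdom M j))
                        (cmap M j \o phi \o cinv N i).

(* The differential of phi at p, as a matrix in the charts i and j.  Vectors
   are rows, so the matrix acts on the right. *)
Definition dmap m n (N : manifold R m) (M : manifold R n) (i : atlas N)
    (j : atlas M) (phi : N -> M) (p : N) : 'M[R]_(m, n) :=
  'J (cmap M j \o phi \o cinv N i) (cmap N i p).

Definition immersion m n (N : manifold R m) (M : manifold R n)
    (phi : N -> M) : Prop :=
  smooth_map phi /\
  forall i j p, cdom N i p -> cdom M j (phi p) -> row_free (dmap i j phi p).

End SmoothMaps.

Section Scalar.
Context {R : realType} {n : nat}.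

Definition gdot (G : 'M[R]_n) (u v : 'rV[R]_n) : R := (u *m G *m v^T) 0 0.

Definition gnorm (G : 'M[R]_n) (v : 'rV[R]_n) : R := Num.sqrt (gdot G v v).

(* a is the angle between v and the row space of W, i.e. between v and its
   orthogonal projection w to that space. *)
Definition angle_to_subspace (G : 'M[R]_n) k (W : 'M[R]_(k, n))
    (v : 'rV[R]_n) (a : R) : Prop :=
  exists w : 'rV[R]_n,
    [/\ (w <= W)%MS,
        forall u : 'rV[R]_n, (u <= W)%MS -> gdot G (v - w) u = 0
      & a = acos (gnorm G w / gnorm G v)].

End Scalar.

(* Tensor fields are given by their components in every chart, subject to the
   transformation law under changes of charts; [dmap i j id p] is the Jacobian
   matrix at p of the change from chart i to chart j. *)
Record riemannianManifold (R : realType) (n : nat) := RiemannianManifold {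
  rmanifold :> manifold R n;
  metric : atlas rmanifold -> rmanifold -> 'M[R]_n;
  metric_smooth : smooth_family metric;
  metric_change : forall i j p,
    cdom rmanifold i p -> cdom rmanifold j p ->
    metric i p = dmap i j id p *m metric j p *m (dmap i j id p)^T;
  metric_sym : forall i p, cdom rmanifold i p -> (metric i p)^T = metric i p;
  metric_pos : forall i p, cdom rmanifold i p ->
    forall v, v != 0 -> 0 < gdot (metric i p) v v
}.

Arguments metric {R n} r.

Section Connections.
Context {R : realType} {n : nat}.

(* Partial derivatives of the components h in the chart i. *)
Definition cpartial (M : manifold R n) (W : normedModType R)
    (h : atlas M -> M -> W) (i : atlas M) (a : 'I_n) (p : M) : W :=
  'D_(delta_mx 0 a) (h i \o cinv M i) (cmap M i p).

(* A linear connection on the tangent bundle is given by its components: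
   Gam i p a b c is the c-th component in the chart i of the covariant
   derivative of the b-th coordinate field along the a-th one. *)
Definition affine_connection (M : manifold R n)
    (Gam : atlas M -> M -> 'I_n -> 'M[R]_n) : Prop :=
  (forall a, smooth_family (fun i p => Gam i p a)) /\
  forall i j p a, cdom M i p -> cdom M j p ->
    Gam i p a *m dmap i j id p =
    'D_(delta_mx 0 a) (fun x => 'J (cmap M j \o cinv M i) x) (cmap M i p) +
    dmap i j id p *m \sum_b dmap i j id p a b *: Gam j p b.

Definition torsion_free (M : manifold R n)
    (Gam : atlas M -> M -> 'I_n -> 'M[R]_n) : Prop :=
  forall i p a b c, cdom M i p -> Gam i p a b c = Gam i p b a c.

Definition metric_connection (M : riemannianManifold R n)
    (Gam : atlas M -> M -> 'I_n -> 'M[R]_n) : Prop :=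
  forall i p a, cdom M i p ->
    cpartial (metric M) i a p =
    Gam i p a *m metric M i p + metric M i p *m (Gam i p a)^T.

Definition levi_civita (M : riemannianManifold R n)
    (Gam : atlas M -> M -> 'I_n -> 'M[R]_n) : Prop :=
  [/\ affine_connection Gam, torsion_free Gam & metric_connection Gam].

(* The field of endomorphisms v |-> v *m J i p has covariant derivative 0. *)
Definition parallel (M : manifold R n)
    (Gam : atlas M -> M -> 'I_n -> 'M[R]_n) (J : atlas M -> M -> 'M[R]_n) :=
  forall i p a, cdom M i p ->
    cpartial J i a p + J i p *m Gam i p a - Gam i p a *m J i p = 0.

End Connections.

Record kaehlerManifold (R : realType) (n : nat) := KaehlerManifold {
  kriemannian :> riemannianManifold R n;
  cstruct : atlas kriemannian -> kriemannian -> 'M[R]_n;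
  cstruct_smooth : smooth_family cstruct;
  cstruct_change : forall i j p,
    cdom kriemannian i p -> cdom kriemannian j p ->
    cstruct i p *m dmap i j id p = dmap i j id p *m cstruct j p;
  cstruct_sq : forall i p, cdom kriemannian i p ->
    cstruct i p *m cstruct i p = - 1%:M;
  cstruct_isometry : forall i p, cdom kriemannian i p ->
    forall u v, gdot (metric kriemannian i p) (u *m cstruct i p)
                  (v *m cstruct i p) =
                gdot (metric kriemannian i p) u v;
  lc_connection : atlas kriemannian -> kriemannian -> 'I_n -> 'M[R]_n;
  lc_connectionP : levi_civita lc_connection;
  cstruct_parallel : parallel lc_connection cstruct
}.

Arguments cstruct {R n} k.

Section Submanifolds.
Context {R : realType}.

Definition isometric_immersion m n (N : riemannianManifold R m)
    (M : riemannianManifold R n) (phi : N -> M) : Prop :=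
  immersion phi /\
  forall i j p, cdom N i p -> cdom M j (phi p) ->
    dmap i j phi p *m metric M j (phi p) *m (dmap i j phi p)^T = metric N i p.

(* Submanifolds of M are immersions phi : N -> M; the tangent space of N at p
   is the row space of [dmap i j phi p]. *)
Definition holomorphic_submanifold m n (N : manifold R m)
    (M : kaehlerManifold R n) (phi : N -> M) : Prop :=
  immersion phi /\
  forall i j p, cdom N i p -> cdom M j (phi p) ->
    stablemx (dmap i j phi p) (cstruct M j (phi p)).

Definition slant_function m n (N : manifold R m) (M : kaehlerManifold R n)
    (phi : N -> M) (theta : N -> R) : Prop :=
  forall i j p, cdom N i p -> cdom M j (phi p) ->
  forall X : 'rV[R]_n, (X <= dmap i j phi p)%MS -> X != 0 ->
    angle_to_subspace (metric M j (phi p)) (dmap i j phi p)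
      (X *m cstruct M j (phi p)) (theta p).

Definition proper_pointwise_slant_submanifold m n (N : manifold R m)
    (M : kaehlerManifold R n) (phi : N -> M) : Prop :=
  immersion phi /\
  exists theta, slant_function phi theta /\ forall p, cos (theta p) != 0.

End Submanifolds.

Section Product.
Context {R : realType} {m n : nat}.
Variables (B : manifold R m) (F : manifold R n).

Lemma prod_hausdorff (T1 T2 : topologicalType) :
  hausdorff_space T1 -> hausdorff_space T2 -> hausdorff_space (T1 * T2)%type.
Proof.
move=> h1 h2 [p1 p2] [q1 q2] cl; congr (_, _).
  apply: h1 => U V Up Vq.
  have [] := cl (fst @^-1` U) (fst @^-1` V).
  - exact: (cvg_fst Up).
  - exact: (cvg_fst Vq).
  by move=> [x y] [/= Ux Vx]; exists x.
apply: h2 => U V Up Vq.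
have [] := cl (snd @^-1` U) (snd @^-1` V).
- exact: (cvg_snd Up).
- exact: (cvg_snd Vq).
by move=> [x y] [/= Ux Vx]; exists y.
Qed.

Lemma open_setX (T1 T2 : topologicalType) (U : set T1) (V : set T2) :
  open U -> open V -> open (U `*` V).
Proof.
move=> oU oV; rewrite openE => -[x y] [/= Ux Vy].
by exists (U, V) => //=; split; apply: open_nbhs_nbhs.
Qed.

Lemma prod_second_countable (T1 T2 : topologicalType) :
  @second_countable T1 -> @second_countable T2 ->
  @second_countable (T1 * T2)%type.
Proof.
move=> [B1 cB1 [oB1 bB1]] [B2 cB2 [oB2 bB2]].
exists [set UV.1 `*` UV.2 | UV in B1 `*` B2].
  exact: (sub_countable (card_image_le _ _) (countableX cB1 cB2)).
split=> [_ [[U V] [/= B1U B2V] <-]|[x y] W].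
  by apply: open_setX; [exact: oB1|exact: oB2].
move=> [[U V] /= [Ux Vy] UVW].
have [U' [B1U' U'x] U'U] := bB1 x U Ux.
have [V' [B2V' V'y] V'V] := bB2 y V Vy.
exists (U' `*` V'); first by split=> //; exists (U', V').
by apply: subset_trans UVW => -[a b] [/= /U'U ? /V'V ?].
Qed.

Lemma row_mx_cvg (T : Type) (G : set_system T) (FG : Filter G)
    (f : T -> 'rV[R]_m) (g : T -> 'rV[R]_n) (a : 'rV[R]_m) (b : 'rV[R]_n) :
  f @ G --> a -> g @ G --> b -> (fun x => row_mx (f x) (g x)) @ G --> row_mx a b.
Proof.
move=> fa gb W [P Pab PW].
have Hf : \forall x \near G, forall k : 'I_m, P 0 (lshift n k) (f x 0 k).
  suff /fa : nbhs a [set A : 'rV_m | forall k, P 0 (lshift n k) (A 0 k)] by [].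
  exists (fun i k => P 0 (lshift n k)) => [i k|A].
    by have := Pab 0 (lshift n k); rewrite row_mxEl ord1.
  by move=> H k; exact: H.
have Hg : \forall x \near G, forall k : 'I_n, P 0 (rshift m k) (g x 0 k).
  suff /gb : nbhs b [set A : 'rV_n | forall k, P 0 (rshift m k) (A 0 k)] by [].
  exists (fun i k => P 0 (rshift m k)) => [i k|A].
    by have := Pab 0 (rshift m k); rewrite row_mxEr ord1.
  by move=> H k; exact: H.
suff : \forall x \near G, W (row_mx (f x) (g x)) by [].
apply: filterS2 Hf Hg => x Hf Hg; apply: PW => i k; rewrite ord1.
by case: (split_ordP k) => k' ->; rewrite ?row_mxEl ?row_mxEr.
Qed.

Definition prod_cdom (ij : atlas B * atlas F) : set (B * F)%type :=
  cdom B ij.1 `*` cdom F ij.2.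

Definition prod_cmap (ij : atlas B * atlas F) (pq : B * F) : 'rV[R]_(m + n) :=
  row_mx (cmap B ij.1 pq.1) (cmap F ij.2 pq.2).

Definition prod_cinv (ij : atlas B * atlas F) (x : 'rV[R]_(m + n)) : B * F :=
  (cinv B ij.1 (lsubmx x), cinv F ij.2 (rsubmx x)).

Lemma prod_image (i : atlas B) (j : atlas F) (U : set B) (V : set F) :
  prod_cmap (i, j) @` (U `*` V) =
  lsubmx @^-1` (cmap B i @` U) `&` rsubmx @^-1` (cmap F j @` V).
Proof.
apply/seteqP; split=> [_ [[p q] [/= Up Vq] <-]|x [[p Up ep] [q Vq eq]]].
  by split; rewrite /prod_cmap /= ?row_mxKl ?row_mxKr; [exists p|exists q].
by exists (p, q) => //; rewrite /prod_cmap /= ep eq hsubmxK.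
Qed.

Lemma overlap_open k (M : manifold R k) (i : atlas M) (U : set M) :
  open U -> open (cmap M i @` (cdom M i `&` U)).
Proof.
move=> oU.
have -> : cmap M i @` (cdom M i `&` U) =
    (cmap M i @` cdom M i) `&` (cinv M i @^-1` U).
  apply/seteqP; split=> [_ [p [dp Up] <-]|_ [[p dp <-]]].
    by split; [exists p|rewrite /preimage /= cmapK].
  by rewrite /preimage /= cmapK // => Up; exists p.
rewrite openE => x [ix /= Ux]; apply: filterI.
  by apply: open_nbhs_nbhs; split => //; exact: cimg_open.
by apply: (cinv_continuous ix); exact: open_nbhs_nbhs.
Qed.

Lemma open_lpreim (U : set 'rV[R]_m) :
  open U -> open ((lsubmx : 'rV[R]_(m + n) -> _) @^-1` U).
Proof. by move=> oU; apply: open_comp => // + _; exact: continuous_lsubmx. Qed.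

Lemma open_rpreim (U : set 'rV[R]_n) :
  open U -> open ((rsubmx : 'rV[R]_(m + n) -> _) @^-1` U).
Proof. by move=> oU; apply: open_comp => // + _; exact: continuous_rsubmx. Qed.

Lemma smooth_lcomp (W : normedModType R) (U : set 'rV[R]_m)
    (V : set 'rV[R]_n) (f : 'rV[R]_m -> W) : open U -> smooth_on U f ->
  smooth_on ((lsubmx : 'rV[R]_(m + n) -> _) @^-1` U `&` rsubmx @^-1` V)
    (f \o lsubmx).
Proof.
move=> oU sf; apply: (@smooth_on_sub _ _ _ _ _ _ (@subIsetl _ _ _)).
exact: (@smooth_on_comp_lin _ _ _ _ _ lsubmx _ oU (@continuous_lsubmx _ _ _ _) sf).
Qed.

Lemma smooth_rcomp (W : normedModType R) (U : set 'rV[R]_m)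
    (V : set 'rV[R]_n) (f : 'rV[R]_n -> W) : open V -> smooth_on V f ->
  smooth_on ((lsubmx : 'rV[R]_(m + n) -> _) @^-1` U `&` rsubmx @^-1` V)
    (f \o rsubmx).
Proof.
move=> oV sf; apply: (@smooth_on_sub _ _ _ _ _ _ (@subIsetr _ _ _)).
exact: (@smooth_on_comp_lin _ _ _ _ _ rsubmx _ oV (@continuous_rsubmx _ _ _ _) sf).
Qed.

Lemma prod_cdom_open ij : open (prod_cdom ij).
Proof. by apply: open_setX; exact: cdom_open. Qed.

Lemma prod_cdom_cover pq : exists ij, prod_cdom ij pq.
Proof.
by have [i ip] := cdom_cover pq.1; have [j jq] := cdom_cover pq.2; exists (i, j).
Qed.

Lemma prod_cimg_open ij : open (prod_cmap ij @` prod_cdom ij).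
Proof.
case: ij => i j; rewrite prod_image.
by apply: openI; [apply: open_lpreim|apply: open_rpreim]; exact: cimg_open.
Qed.

Lemma prod_cmapK ij pq : prod_cdom ij pq -> prod_cinv ij (prod_cmap ij pq) = pq.
Proof.
case: ij pq => i j [p q] [/= dp dq].
by rewrite /prod_cinv /prod_cmap /= row_mxKl row_mxKr !cmapK.
Qed.

Lemma prod_cmap_continuous ij pq :
  prod_cdom ij pq -> {for pq, continuous (prod_cmap ij)}.
Proof.
case: ij pq => i j [p q] [/= dp dq]; apply: row_mx_cvg => /=.
  apply: (cvg_comp _ _ cvg_fst); exact: (cmap_continuous dp).
apply: (cvg_comp _ _ cvg_snd); exact: (cmap_continuous dq).
Qed.

Lemma prod_cinv_continuous ij x : (prod_cmap ij @` prod_cdom ij) x ->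
  {for x, continuous (prod_cinv ij)}.
Proof.
case: ij => i j; rewrite prod_image => -[xl xr].
have cl : {for x, continuous (cinv B i \o lsubmx)}.
  by apply: continuous_comp; [exact: continuous_lsubmx|exact: (cinv_continuous xl)].
have cr : {for x, continuous (cinv F j \o rsubmx)}.
  by apply: continuous_comp; [exact: continuous_rsubmx|exact: (cinv_continuous xr)].
exact: (cvg_pair cl cr).
Qed.

Lemma prod_overlap (i i' : atlas B) (j j' : atlas F) :
  prod_cmap (i, j) @` (prod_cdom (i, j) `&` prod_cdom (i', j')) =
  lsubmx @^-1` (cmap B i @` (cdom B i `&` cdom B i')) `&`
  rsubmx @^-1` (cmap F j @` (cdom F j `&` cdom F j')).
Proof.
rewrite -prod_image; congr (_ @` _).
by apply/seteqP; split=> [[p q] [[/= ? ?] [/= ? ?]]|[p q] [/= [? ?] [? ?]]].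
Qed.

Lemma prod_transition_smooth ij ij' :
  smooth_on (prod_cmap ij @` (prod_cdom ij `&` prod_cdom ij'))
    (prod_cmap ij' \o prod_cinv ij).
Proof.
case: ij ij' => i j [i' j']; rewrite prod_overlap.
have oB : open (cmap B i @` (cdom B i `&` cdom B i')).
  by apply: overlap_open; exact: cdom_open.
have oF : open (cmap F j @` (cdom F j `&` cdom F j')).
  by apply: overlap_open; exact: cdom_open.
have oU := openI (open_lpreim oB) (open_rpreim oF).
apply/smooth_mxP => // a k; rewrite ord1 /prod_cmap /prod_cinv /comp /=.
have -> : (fun x : 'rV[R]_(m + n) =>
   (row_mx (cmap B i' (cinv B i (lsubmx x)))
      (cmap F j' (cinv F j (rsubmx x)))) (0 : 'I_1) k) =
   match fintype.split k with
   | inl k1 => (fun y => (cmap B i' \o cinv B i) y 0 k1) \o lsubmx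
   | inr k2 => (fun y => (cmap F j' \o cinv F j) y 0 k2) \o rsubmx
   end.
  by apply/funext => x; rewrite mxE; case: (fintype.split k).
case: (fintype.split k) => k'.
  apply: smooth_lcomp => //; move: (0 : 'I_1) k'; apply/smooth_mxP => //; exact: transition_smooth.
apply: smooth_rcomp => //; move: (0 : 'I_1) k'; apply/smooth_mxP => //; exact: transition_smooth.
Qed.

Definition prod_manifold : manifold R (m + n) :=
  @Manifold R (m + n) (B * F)%type (atlas B * atlas F)%type
    prod_cdom prod_cmap prod_cinv
    (prod_hausdorff (mspace_hausdorff (m := B)) (mspace_hausdorff (m := F)))
    (prod_second_countable (mspace_second_countable B)
       (mspace_second_countable F))
    prod_cdom_open prod_cdom_cover prod_cimg_open prod_cmapK
    prod_cmap_continuous prod_cinv_continuous prod_transition_smooth.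

End Product.

(* The warping function f : B -> (0, oo). *)
Record warping_function (R : realType) (n : nat) (B : manifold R n) :=
  WarpingFunction {
  wfun :> B -> R;
  wfun_gt0 : forall p, 0 < wfun p;
  wfun_smooth : smooth_fun wfun
}.

Section WarpedProduct.
Context {R : realType} {m n : nat}.
Variables (B : riemannianManifold R m) (F : riemannianManifold R n).
Variable f : warping_function B.

Definition warped_metric (ij : atlas (prod_manifold B F))
    (pq : prod_manifold B F) : 'M[R]_(m + n) :=
  block_mx (metric B ij.1 pq.1) 0 0 (f pq.1 ^+ 2 *: metric F ij.2 pq.2).

Lemma warped_metric_smooth : smooth_family warped_metric.
Proof.
move=> [i j].
have oB := @cimg_open R m B i; have oF := @cimg_open R n F j.
rewrite [X in smooth_on X]prod_image.
have oU := openI (open_lpreim oB) (open_rpreim oF).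
have sB a b : smooth_on (cmap B i @` cdom B i) (fun y => (metric B i \o cinv B i) y a b).
  by move: a b; apply/smooth_mxP => //; exact: metric_smooth.
have sF a b : smooth_on (cmap F j @` cdom F j) (fun y => (metric F j \o cinv F j) y a b).
  by move: a b; apply/smooth_mxP => //; exact: metric_smooth.
have sf : smooth_on (cmap B i @` cdom B i) (f \o cinv B i) by exact: (wfun_smooth f).
apply/smooth_mxP => // a b; rewrite /warped_metric /comp /=.
have -> : (fun x : 'rV[R]_(m + n) =>
   (block_mx (metric B i (cinv B i (lsubmx x))) 0 0
    (f (cinv B i (lsubmx x)) ^+ 2 *: metric F j (cinv F j (rsubmx x)))) a b) =
   match fintype.split a, fintype.split b with
   | inl a1, inl b1 => (fun y => (metric B i \o cinv B i) y a1 b1) \o lsubmx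
   | inr a2, inr b2 => fun x => ((fun y => (f \o cinv B i) y * (f \o cinv B i) y) \o lsubmx) x *
         ((fun y => (metric F j \o cinv F j) y a2 b2) \o rsubmx) x
   | _, _ => fun=> 0
   end.
  apply/funext => x; rewrite mxE; case: (fintype.split a) => a'; rewrite mxE;
    case: (fintype.split b) => b' //=; rewrite ?mxE ?expr2 //.
case: (fintype.split a) => a'; case: (fintype.split b) => b'.
- exact: smooth_lcomp.
- exact: smooth_on_cst.
- exact: smooth_on_cst.
- apply: smooth_onM => //; last exact: smooth_rcomp.
  by apply: smooth_lcomp => //; exact: smooth_onM.
Qed.

Lemma prod_jacobian (i i' : atlas B) (j j' : atlas F) p q :
  cdom B i p -> cdom B i' p -> cdom F j q -> cdom F j' q ->
  @dmap R _ _ (prod_manifold B F) (prod_manifold B F) (i, j) (i', j') id (p, q) =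
  block_mx (dmap i i' id p) 0 0 (dmap j j' id q).
Proof.
move=> ip i'p jq j'q.
set D := dmap _ _ _ _; apply/row_matrixP => a; rewrite !rowE.
move: (delta_mx 0 a) => v; rewrite {}/D /dmap.
have dP : differentiable (cmap (prod_manifold B F) (i', j') \o id \o
    cinv (prod_manifold B F) (i, j)) (cmap (prod_manifold B F) (i, j) (p, q)).
  apply: (smooth_on_differentiable (@transition_smooth _ _ (prod_manifold B F) (i, j) (i', j'))).
  by exists (p, q).
have dB : differentiable (cmap B i' \o id \o cinv B i) (cmap B i p).
  by apply: (smooth_on_differentiable (@transition_smooth _ _ B i i')); exists p.
have dF : differentiable (cmap F j' \o id \o cinv F j) (cmap F j q).
  by apply: (smooth_on_differentiable (@transition_smooth _ _ F j j')); exists q.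
rewrite -deriveEjacobian // -[v in RHS]hsubmxK mul_row_block !mulmx0 addr0 add0r.
rewrite -!deriveEjacobian //.
have dB' : differentiable (cmap B i' \o id \o cinv B i)
    (lsubmx (cmap (prod_manifold B F) (i, j) (p, q))) by rewrite row_mxKl.
have dF' : differentiable (cmap F j' \o id \o cinv F j)
    (rsubmx (cmap (prod_manifold B F) (i, j) (p, q))) by rewrite row_mxKr.
apply/rowP => k; rewrite -derive_coord // !mxE.
case: split_ordP => k' ->.
  rewrite -[cmap B i p](@row_mxKl _ _ _ _ _ (cmap F j q)) .
  rewrite -(@derive_comp_lin _ _ _ _ lsubmx) //; last exact: continuous_lsubmx.
  rewrite -derive_coord; last first.
    by apply: differentiable_comp => //; exact: differentiable_lsubmx.
  by congr ('D_v _ _); apply/funext => x; rewrite /comp /= row_mxEl.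
rewrite -[cmap F j q](@row_mxKr _ _ _ _ (cmap B i p)).
rewrite -(@derive_comp_lin _ _ _ _ rsubmx) //; last exact: continuous_rsubmx.
rewrite -derive_coord; last first.
  by apply: differentiable_comp => //; exact: differentiable_rsubmx.
by congr ('D_v _ _); apply/funext => x; rewrite /comp /= row_mxEr.
Qed.

Lemma warped_metric_change (ij ij' : atlas (prod_manifold B F)) pq :
  cdom (prod_manifold B F) ij pq -> cdom (prod_manifold B F) ij' pq ->
  warped_metric ij pq =
  dmap ij ij' id pq *m warped_metric ij' pq *m (dmap ij ij' id pq)^T.
Proof.
case: ij ij' pq => i j [i' j'] [p q] [/= ip jq] [/= i'p j'q].
rewrite prod_jacobian // /warped_metric /= tr_block_mx !mulmx_block.
rewrite !(trmx0, mulmx0, mul0mx, addr0, add0r).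
rewrite -(metric_change ip i'p) -scalemxAr -scalemxAl.
by rewrite -(metric_change jq j'q).
Qed.

Lemma warped_metric_sym ij pq : cdom (prod_manifold B F) ij pq ->
  (warped_metric ij pq)^T = warped_metric ij pq.
Proof.
case: ij pq => i j [p q] [/= ip jq].
by rewrite /warped_metric tr_block_mx !trmx0 linearZ /= !metric_sym.
Qed.

Lemma warped_metric_pos ij pq : cdom (prod_manifold B F) ij pq ->
  forall v, v != 0 -> 0 < gdot (warped_metric ij pq) v v.
Proof.
case: ij pq => i j [p q] [/= ip jq] v; rewrite -[v]hsubmxK.
move: (lsubmx v) (rsubmx v) => x y {v} xy0.
have ge0 k (M : riemannianManifold R k) a r z : cdom M a r ->
    0 <= gdot (metric M a r) z z.
  move=> ar; have [->|z0] := eqVneq z 0; first by rewrite /gdot !mul0mx mxE.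
  by apply/ltW; exact: metric_pos.
rewrite /gdot /warped_metric mul_row_block !mulmx0 addr0 add0r tr_row_mx.
rewrite mul_row_col mxE -scalemxAr -scalemxAl [X in _ + X]mxE /=.
rewrite -/(gdot (metric B i p) x x) -/(gdot (metric F j q) y y).
have f2 : 0 < f p ^+ 2 by rewrite exprn_gt0 // wfun_gt0.
have [x0|x0] := eqVneq x 0.
  have y0 : y != 0 by apply: contra_neq xy0 => ->; rewrite x0 row_mx0.
  by rewrite ltr_wpDl ?ge0 // mulr_gt0 // metric_pos.
by rewrite ltr_wpDr ?metric_pos // mulr_ge0 ?ge0 // ltW.
Qed.

Definition warped_product : riemannianManifold R (m + n) :=
  @RiemannianManifold R (m + n) (prod_manifold B F) warped_metric
    warped_metric_smooth warped_metric_change warped_metric_sym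
    warped_metric_pos.

End WarpedProduct.

(* Constancy of f is a meaningful condition on the warped product only over a
   connected base and for a nonempty fibre of positive dimension. *)
Definition trivial_warping (R : realType) n (B : manifold R n)
    (f : warping_function B) : Prop :=
  exists c, forall p, f p = c.

(* Main.v *)
Require Import Defs.
From mathcomp Require Import all_boot all_order all_algebra.
From mathcomp Require Import all_classical all_reals all_analysis.
From mathcomp Require Import ring lra zify.

(* Let omega (u, v) = g (u, J v) be the Kaehler form; it is closed since nabla J = 0
   and nabla is torsion free.  On the warped product, omega vanishes on pairs of
   a base vector and a fibre vector, because the tangent spaces of the fibre are
   J-invariant and orthogonal to the base.  Evaluating d omega = 0 on one base
   vector and two fibre coordinate fields, the components of omega along the
   fibre are therefore constant in the base directions.  At (p, q) they form the
   matrix f(p)^2 g_T(q) S^T, where S is the matrix of J on the fibre and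
   S^2 = - 1, so their determinant has square
   f(p)^(4 t) det(g_T(q))^2 (-1)^t; since t > 0, f is locally constant. *)

Set Implicit Arguments.
Unset Strict Implicit.
Unset Printing Implicit Defensive.

Import Order.TTheory GRing.Theory Num.Theory.
Import numFieldNormedType.Exports.

Local Open Scope classical_set_scope.
Local Open Scope ring_scope.

(** * Directional derivatives: symmetry of second derivatives and product rules for matrices *)

Section Analysis.
Context {R : realType}.
Implicit Types V W : normedModType R.

(** Restriction to a line turns ['D_v] into a derivative in one real variable, to which the mean
    value theorem applies. *)
Lemma is_derive_line V W (f : V -> W) (x v : V) (s : R) :
  differentiable f (x + s *: v) ->
  is_derive s 1 (fun t : R => f (x + t *: v)) ('D_v f (x + s *: v)).
Proof.
move=> df; rewrite /derive; have := @diff_derivable _ _ _ f _ v df; rewrite /derivable.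
have E : (fun h : R => h^-1 *: ((f \o shift (x + s *: v)) (h *: v) - f (x + s *: v))) =
  (fun h : R => h^-1 *: (((fun t : R => f (x + t *: v)) \o shift s) (h *: 1) -
     (fun t : R => f (x + t *: v)) s)).
  by apply/funext => h /=; rewrite [h *: 1]mulr1 scalerDl addrCA.
by rewrite E => cf; apply: DeriveDef.
Qed.

(** A directional derivative only sees the map along one line, so maps on different spaces can be
    compared: later, a fibre slice and the whole product. *)
Lemma derive_eq_line V V' W (g : V -> W) (f : V' -> W)
    (v y : V) (v' x : V') :
  (forall h : R, g (h *: v + y) = f (h *: v' + x)) -> 'D_v g y = 'D_v' f x.
Proof.
move=> E; rewrite /derive.
have E0 : g y = f x by have := E 0; rewrite !scale0r !add0r.
have -> : (fun h : R => h^-1 *: ((g \o shift y) (h *: v) - g y)) =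
    (fun h : R => h^-1 *: ((f \o shift x) (h *: v') - f x)).
  by apply/funext => h /=; rewrite E E0.
by [].
Qed.

Lemma derive0_constant_line V (f : V -> R) (x v : V) :
  (forall s : R, 0 <= s <= 1 -> differentiable f (x + s *: v) /\ 'D_v f (x + s *: v) = 0) ->
  f (x + v) = f x.
Proof.
move=> df.
have dl (s : R) : s \in `[0, 1]%R -> is_derive s 1 (fun t : R => f (x + t *: v)) 0.
  rewrite in_itv/= => /df[dfs <-]; exact: is_derive_line.
have dloo (s : R) : s \in `]0, 1[%R -> is_derive s 1 (fun t : R => f (x + t *: v)) ((fun=> 0) s).
  by move=> s01; apply: dl; apply: subset_itv_oo_cc s01.
have cl : {within `[0, 1], continuous (fun t : R => f (x + t *: v))}.
  by apply: derivable_within_continuous => s s01; have [] := dl _ s01.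
have [s _] := MVT_segment ler01 dloo cl.
by rewrite scale1r scale0r addr0 mul0r => /eqP; rewrite subr_eq0 => /eqP.
Qed.

(** The second difference is the increment along [h *: u] of a first difference along [h *: v]. The
    mean value theorem makes it [h] times a difference of two values of ['D_u f], and the
    first-order expansion of ['D_u f] at [x] yields the mixed derivative. *)
Lemma second_difference_estimate V (f : V -> R) (U : set V) (x u v : V) :
  open U -> U x -> (forall y, U y -> differentiable f y) ->
  differentiable ('D_u f) x ->
  forall e : R, 0 < e -> \forall h \near (0 : R),
   `|f (x + h *: u + h *: v) - f (x + h *: u) - f (x + h *: v) + f x -
     h ^+ 2 * 'D_v ('D_u f) x| <= e * h ^+ 2.
Proof.
move=> oU Ux df dg e e0; set g := 'D_u f.
(* |h| [C] bounds the norm on the parallelogram spanned by [h *: u] and [h *: v]; the summand 1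
   keeps [C] positive when both vectors vanish. *)
set C := `|u| + `|v| + 1.
have C0 : 0 < C by rewrite /C ltr_pwDr// addr_ge0.
have := (diff_locallyP x g).1 dg => -[cdg /eqaddoP].
(* The expansion is used at two points, and each error must be at most half of [e] times |h|. *)
have e'0 : 0 < e / (2 * C) by rewrite divr_gt0// mulr_gt0.
move=> /(_ _ e'0) /= /nbhs_ballP[r /= r0 Hr].
have /nbhs_ballP[r' /= r'0 Hr'] : nbhs x U by apply: open_nbhs_nbhs.
near=> h.
have hC : `|h| * C < Num.min r r'.
  rewrite -ltr_pdivlMr//; near: h.
  apply/nbhs_ballP; exists (Num.min r r' / C) => /=.
    by rewrite divr_gt0// lt_min r0.
  by move=> h; rewrite -ball_normE /ball_/= sub0r normrN.
move: hC; rewrite lt_min => /andP[hr hr'].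
have small (s t : R) : 0 <= s <= 1 -> 0 <= t <= 1 ->
    `|s *: (h *: u) + t *: (h *: v)| <= `|h| * C.
  move=> /andP[s0 s1] /andP[t0 t1]; apply: (le_trans (ler_normD _ _)).
  rewrite !normrZ (ger0_norm s0) (ger0_norm t0) /C.
  have : s * (`|h| * `|u|) <= `|h| * `|u| by rewrite ler_piMl// mulr_ge0.
  have : t * (`|h| * `|v|) <= `|h| * `|v| by rewrite ler_piMl// mulr_ge0.
  have := normr_ge0 h; rewrite !mulrDr mulr1; lra.
have inU (s t : R) : 0 <= s <= 1 -> 0 <= t <= 1 -> U (x + (s *: (h *: u) + t *: (h *: v))).
  move=> s01 t01; apply: Hr'; rewrite -ball_normE /ball_/= opprD addrA subrr sub0r normrN.
  exact: le_lt_trans (small _ _ s01 t01) hr'.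
have est (s t : R) : 0 <= s <= 1 -> 0 <= t <= 1 ->
    `|g (x + (s *: (h *: u) + t *: (h *: v))) - g x -
      'd g x (s *: (h *: u) + t *: (h *: v))| <= e / 2 * `|h|.
  move=> s01 t01; have sm := small _ _ s01 t01.
  set w := _ + _ in sm *.
  have := Hr w; rewrite -ball_normE /ball_/= sub0r normrN => /(_ (le_lt_trans sm hr)).
  rewrite !fctE /= [w + x]addrC opprD addrA => /le_trans; apply.
  apply: le_trans (ler_wpM2l (ltW e'0) sm) _.
  rewrite le_eqVlt; apply/orP; left; apply/eqP; field.
  by rewrite gt_eqF.
have fline (y : V) (s : R) : U (y + s *: (h *: u)) ->
    is_derive s 1 (fun t : R => f (y + t *: (h *: u))) (h * g (y + s *: (h *: u))).
  move=> Uy; have dfy := df _ Uy; apply: is_derive_eq (is_derive_line dfy) _.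
  by rewrite /g !deriveE// linearZ.
have inU0 (s : R) : 0 <= s <= 1 -> U (x + s *: (h *: u)).
  by move=> s01; have := inU s 0 s01; rewrite lexx ler01 scale0r addr0; exact.
have inU1 (s : R) : 0 <= s <= 1 -> U (x + h *: v + s *: (h *: u)).
  move=> s01; have := inU s 1 s01; rewrite lexx ler01 scale1r addrAC -addrA; exact.
(* Mean value theorem along u; the increment of g is then estimated by 'd g x. *)
pose F (t : R) := f (x + h *: v + t *: (h *: u)) - f (x + t *: (h *: u)).
pose dF (t : R) := h * g (x + h *: v + t *: (h *: u)) - h * g (x + t *: (h *: u)).
have dFP (s : R) : s \in `[0, 1]%R -> is_derive s 1 F (dF s).
  rewrite in_itv/= => s01; apply: is_deriveB; apply: fline; [exact: inU1|exact: inU0].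
have dFoo (s : R) : s \in `]0, 1[%R -> is_derive s 1 F (dF s).
  by move=> s01; apply: dFP; apply: subset_itv_oo_cc s01.
have cF : {within `[0, 1], continuous F}.
  apply: derivable_within_continuous => s s01; by have [] := dFP _ s01.
have [s s01 E] := MVT_segment ler01 dFoo cF.
move: s01 E; rewrite in_itv/= /F /dF scale0r !addr0 scale1r subr0 mulr1 => s01 E.
have e1 := est s 1 s01; have e2 := est s 0 s01.
move: e1 e2; rewrite !lexx ler01 scale1r scale0r addr0 => /(_ isT) e1 /(_ isT) e2.
have L : 'd g x (s *: (h *: u) + h *: v) = 'd g x (s *: (h *: u)) + h * 'D_v g x.
  by rewrite linearD (deriveE v dg); congr (_ + _); exact: linearZ.
move: e1; rewrite L.
rewrite [s *: _ + _]addrC addrA => e1.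
rewrite [x + h *: u + _]addrAC.
have -> : f (x + h *: v + h *: u) - f (x + h *: u) - f (x + h *: v) + f x =
   h * (g (x + h *: v + s *: (h *: u)) - g (x + s *: (h *: u))).
  by rewrite mulrBr -E; ring.
move: e1 e2; set P := g (_ + _ *: v + _); set Q := g (x + _); set D := 'D_v g x.
set T := 'd g x _ => e1 e2.
(* The terms [g x] and [T] are common to both expansions and cancel, leaving only the increment
   [h * D] along [v]. *)
have -> : h * (P - Q) - h ^+ 2 * D = h * ((P - g x - (T + h * D)) - (Q - g x - T)).
  by ring.
rewrite normrM -(real_normK (num_real h)) expr2 mulrA [e * _]mulrC -mulrA ler_wpM2l//.
by apply: le_trans (ler_normB _ _) _; rewrite [e in leRHS]splitr mulrDl lerD.
Unshelve. all: by end_near. Qed.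

(** The second difference is symmetric in [u] and [v]; divided by [h ^+ 2] for a small [h], it is
    within [e / 2] of both mixed derivatives. *)
Lemma derive_commute V (f : V -> R) (U : set V) (x u v : V) :
  open U -> smooth_on U f -> U x -> 'D_v ('D_u f) x = 'D_u ('D_v f) x.
Proof.
move=> oU sf Ux; apply/eqP; rewrite -subr_eq0 -normr_le0; apply/ler_addgt0Pr => e e0.
rewrite add0r.
have df y : U y -> differentiable f y by exact: smooth_on_differentiable.
have ddf w : differentiable ('D_w f) x.
  exact: (smooth_on_differentiable (smooth_on_derive w sf) Ux).
have e20 : 0 < e / 2 by rewrite divr_gt0.
have n1 := second_difference_estimate v oU Ux df (ddf u) e20.
have n2 := second_difference_estimate u oU Ux df (ddf v) e20.
have [r /= r0 Hr] := (nbhs_ballP _ _).1 (filterI n1 n2).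
pose h := r / 2; have h0 : 0 < h by rewrite divr_gt0.
have [|] := Hr h.
  by rewrite -ball_normE /ball_/= sub0r normrN gtr0_norm// ltr_pdivrMr// ltr_pMr// ltr1n.
rewrite [x + h *: v + h *: u]addrAC.
set A := f _; set B := f _; set C := f _; set D := f _; set E := 'D_v _ _; set G := 'D_u _ _.
clearbody A B C D E G h.
move=> a1 a2.
have h20 : 0 < h ^+ 2 by rewrite exprn_gt0.
rewrite -(ler_pM2r h20) -[X in _ * X <= _](gtr0_norm h20) -normrM.
have -> : (E - G) * h ^+ 2 = (A - C - B + D - h ^+ 2 * G) - (A - B - C + D - h ^+ 2 * E) by ring.
apply: le_trans (ler_normB _ _) _; rewrite [e in leRHS]splitr mulrDl.
apply: lerD; [exact: a2|exact: a1].
Qed.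

Lemma derive_commute_mx V m n (f : V -> 'M[R]_(m, n)) (U : set V) (x u v : V) :
  open U -> smooth_on U f -> U x -> 'D_v ('D_u f) x = 'D_u ('D_v f) x.
Proof.
move=> oU sf Ux; apply/matrixP => i j.
have dd w y : U y -> differentiable ('D_w f) y :=
  smooth_on_differentiable (smooth_on_derive w sf).
have C w z : 'D_w ('D_z f) x i j = 'D_w ('D_z (fun y => f y i j)) x.
  rewrite -derive_coord; last exact: dd.
  apply: near_eq_derive; apply: filterS (open_nbhs_nbhs (conj oU Ux)) => y Uy.
  by rewrite derive_coord//; exact: smooth_on_differentiable Uy.
have Cvu := C v u.
have Cuv := C u v.
have sfij := (smooth_mxP f oU).1 sf i j.
have E := derive_commute u v oU sfij Ux.
exact: etrans Cvu (etrans E (esym Cuv)).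
Qed.

Lemma differentiable_coord_mx V m n (f : V -> 'M[R]_(m, n)) x i j :
  differentiable f x -> differentiable (fun y => f y i j) x.
Proof.
move=> df; apply: (@differentiable_comp _ _ _ _ f (@coord_lin R m n i j)) => //.
by apply: linear_differentiable; exact: coord_continuous.
Qed.

Lemma differentiable_mulmx V m n k (A : V -> 'M[R]_(m, n)) (B : V -> 'M[R]_(n, k)) x :
  differentiable A x -> differentiable B x -> differentiable (fun y => A y *m B y) x.
Proof.
move=> dA dB; apply: differentiable_mx => i j.
have -> : (fun y => (A y *m B y) i j) = \sum_l (fun y => A y i l) * (fun y => B y l j).
  by apply/funext => y; rewrite mxE fct_sumE.
by apply: differentiable_sum => l; apply: differentiableM; exact: differentiable_coord_mx.
Qed.

Lemma derive_mulmx V m n k (A : V -> 'M[R]_(m, n)) (B : V -> 'M[R]_(n, k)) x v :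
  differentiable A x -> differentiable B x ->
  'D_v (fun y => A y *m B y) x = 'D_v A x *m B x + A x *m 'D_v B x.
Proof.
move=> dA dB; apply/matrixP => i j.
rewrite -derive_coord; last exact: differentiable_mulmx.
have -> : (fun y => (A y *m B y) i j) = \sum_l (fun y => A y i l) * (fun y => B y l j).
  by apply/funext => y; rewrite mxE fct_sumE.
have dAi l : derivable (fun y => A y i l) x v.
  by apply: diff_derivable; exact: differentiable_coord_mx.
have dBi l : derivable (fun y => B y l j) x v.
  by apply: diff_derivable; exact: differentiable_coord_mx.
rewrite derive_sum => [|l]; last exact: derivableM.
rewrite !mxE -big_split; apply: eq_bigr => l _ /=.
by rewrite deriveM// !derive_coord// addrC [B x l j *: _]mulrC.
Qed.

Lemma differentiable_trmx V m n (A : V -> 'M[R]_(m, n)) x :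
  differentiable A x -> differentiable (fun y => (A y)^T) x.
Proof.
move=> dA; apply: differentiable_mx => i j.
have -> : (fun y => (A y)^T i j) = (fun y => A y j i) by apply/funext => y; rewrite mxE.
exact: differentiable_coord_mx.
Qed.

Lemma derive_trmx V m n (A : V -> 'M[R]_(m, n)) x v :
  differentiable A x -> 'D_v (fun y => (A y)^T) x = ('D_v A x)^T.
Proof.
move=> dA; apply/matrixP => i j.
rewrite -derive_coord; last exact: differentiable_trmx.
have -> : (fun y => (A y)^T i j) = (fun y => A y j i) by apply/funext => y; rewrite mxE.
by rewrite [RHS]mxE; exact: derive_coord.
Qed.

End Analysis.

(** * Closedness of the pullback of a parallel 2-form under a torsion-free connection *)

Section PullbackClosed.
Context {R : realType}.

Lemma derive_rowE (W : normedModType R) n (f : 'rV[R]_n -> W) (x v : 'rV[R]_n) :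
  differentiable f x -> 'D_v f x = \sum_c v 0 c *: 'D_(delta_mx 0 c) f x.
Proof.
move=> df; rewrite deriveE// [in LHS](row_sum_delta v) linear_sum.
by apply: eq_bigr => c _; rewrite linearZ deriveE.
Qed.

Lemma trmx11 (A : 'M[R]_1) : A^T = A.
Proof. by apply/matrixP => i j; rewrite mxE !ord1. Qed.

Lemma derive_sandwich (V : normedModType R) m n k (A : V -> 'M[R]_(m, n)) (O : V -> 'M[R]_n)
    (B : V -> 'M[R]_(k, n)) (x v : V) dA dO dB :
  differentiable A x -> differentiable O x -> differentiable B x ->
  'D_v A x = dA -> 'D_v O x = dO -> 'D_v B x = dB ->
  'D_v (fun y => A y *m O y *m (B y)^T) x =
  dA *m O x *m (B x)^T + A x *m dO *m (B x)^T + A x *m O x *m dB^T.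
Proof.
move=> diffA diffO diffB <- <- <-.
have diffAO := differentiable_mulmx diffA diffO.
apply: etrans (derive_mulmx v diffAO (differentiable_trmx diffB)) _.
rewrite -mulmxDl -(derive_mulmx v diffA diffO); congr (_ + _ *m _).
exact: derive_trmx.
Qed.

(** A 1 by 1 matrix equals its transpose, so antisymmetry of [Om] makes [B] antisymmetric; then
    [B (A s t) (d r)] and [B (d r) (A t s)] cancel in the cyclic sum. *)
Lemma cyclic_form_sum (V : Type) n (Om : 'M[R]_n) (d : V -> 'rV[R]_n)
    (A : V -> V -> 'rV[R]_n) (u v w : V) :
  Om^T = - Om -> (forall s t, A s t = A t s) ->
  let D s t r := A s t *m Om *m (d r)^T + d t *m Om *m (A s r)^T in
  D u v w + D v w u + D w u v = 0.
Proof.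
move=> antiOm symA D; pose B (p q : 'rV[R]_n) := p *m Om *m q^T.
have antiB p q : B p q = - B q p.
  by rewrite /B -[LHS]trmx11 !trmx_mul trmxK antiOm mulNmx mulmxN mulmxA.
rewrite /D -!/(B _ _) (symA v u) (symA w u) (symA w v).
rewrite (antiB _ (A u v)) (antiB _ (A u w)) (antiB _ (A v w)).
by apply/matrixP => i j; rewrite !mxE; ring.
Qed.

(* The term A s t in the proof is the covariant derivative of D_t Phi along D_s Phi;
   it is symmetric, so the six terms of the cyclic sum cancel in pairs. *)
Lemma pullback_closed (V : normedModType R) n (U : set V) (Phi : V -> 'rV[R]_n)
    (Om : 'rV[R]_n -> 'M[R]_n) (Gam : 'I_n -> 'M[R]_n) (x u v w : V) :
  open U -> smooth_on U Phi -> U x ->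
  differentiable Om (Phi x) ->
  (forall c, 'D_(delta_mx 0 c) Om (Phi x) =
     Gam c *m Om (Phi x) + Om (Phi x) *m (Gam c)^T) ->
  (forall a b c, Gam a b c = Gam b a c) ->
  (Om (Phi x))^T = - Om (Phi x) ->
  let pull (s t : V) := fun y => 'D_s Phi y *m Om (Phi y) *m ('D_t Phi y)^T in
  'D_u (pull v w) x + 'D_v (pull w u) x + 'D_w (pull u v) x = 0.
Proof.
move=> oU sPhi Ux dOm DOm symG antiOm pull.
have diffPhi : differentiable Phi x := smooth_on_differentiable sPhi Ux.
have diff2Phi s : differentiable ('D_s Phi) x :=
  smooth_on_differentiable (smooth_on_derive s sPhi) Ux.
have dOP : differentiable (Om \o Phi) x by exact: differentiable_comp.
(* The existentials make the first and second derivatives at [x] opaque, so that the rest is matrix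
   algebra. *)
have [d dE] : exists d : V -> 'rV[R]_n, forall s, 'D_s Phi x = d s by exists (fun s => 'D_s Phi x).
have [dd ddE] : exists dd : V -> V -> 'rV[R]_n, forall s t, 'D_s ('D_t Phi) x = dd s t.
  by exists (fun s t => 'D_s ('D_t Phi) x).
have ddC s t : dd s t = dd t s.
  exact: etrans (esym (ddE s t)) (etrans (derive_commute_mx t s oU sPhi Ux) (ddE t s)).
(* [Gm s] is the connection matrix in the direction ['D_s Phi x]; by the chain rule, parallelism of
   the form passes to [Om \o Phi]. *)
pose Gm (s : V) := \sum_c (d s) 0 c *: Gam c.
have DOP s : 'D_s (Om \o Phi) x = Gm s *m Om (Phi x) + Om (Phi x) *m (Gm s)^T.
  have -> : 'D_s (Om \o Phi) x = 'D_(d s) Om (Phi x).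
    by rewrite -dE !deriveE// diff_comp.
  rewrite derive_rowE// /Gm mulmx_suml linear_sum mulmx_sumr -big_split.
  apply: eq_bigr => c _; rewrite DOm linearZ /=.
  by rewrite -scalemxAl -scalemxAr scalerDr.
pose A (s t : V) := dd s t + d t *m Gm s.
have symA s t : A s t = A t s.
  (* The first summand is symmetric because second derivatives commute, the second because the
     connection is torsion free. *)
  rewrite /A ddC; congr (_ + _); apply/rowP => e; rewrite /Gm !mxE.
  under eq_bigr do rewrite summxE mulr_sumr.
  under [RHS]eq_bigr do rewrite summxE mulr_sumr.
  rewrite exchange_big; apply: eq_bigr => b _; apply: eq_bigr => c _ /=.
  by rewrite !mxE symG mulrCA.
have D s t r : 'D_s (pull t r) x = A s t *m Om (Phi x) *m (d r)^T + d t *m Om (Phi x) *m (A s r)^T.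
  apply: etrans (derive_sandwich (diff2Phi t) dOP (diff2Phi r) (ddE s t) (DOP s) (ddE s r)) _.
  have -> : 'D_t Phi x = d t by exact: dE.
  have -> : 'D_r Phi x = d r by exact: dE.
  rewrite /A /= !linearD /= trmx_mul !(mulmxDl, mulmxDr) !mulmxA !addrA.
  by rewrite -!addrA; congr (_ + (_ + _)); rewrite addrC.
have := cyclic_form_sum d u v w antiOm symA; apply: etrans.
exact: (congr2 +%R (congr2 +%R (D u v w) (D v w u)) (D w u v)).
Qed.

End PullbackClosed.

(** * The Kaehler form in charts: antisymmetry and parallelism *)

Section KaehlerForm.
Context {R : realType}.

Lemma gdot_inj n (G H : 'M[R]_n) :
  (forall u v, gdot G u v = gdot H u v) -> G = H.
Proof.
move=> GH; apply/matrixP => i j; have := GH (delta_mx 0 i) (delta_mx 0 j).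
by rewrite /gdot -!rowE trmx_delta -!colE !mxE.
Qed.

Lemma posdef_det_neq0 n (G : 'M[R]_n) :
  (forall v, v != 0 -> 0 < gdot G v v) -> \det G != 0.
Proof.
move=> pG; apply/det0P => -[v v0 vG].
by have := pG v v0; rewrite /gdot vG mul0mx mxE ltxx.
Qed.

Variables (n : nat) (M : kaehlerManifold R n).

(* Vectors are rows: g (u, J v) = u *m kaehler_form *m v^T. *)
Definition kaehler_form (k : atlas M) (p : M) : 'M[R]_n :=
  metric M k p *m (cstruct M k p)^T.

(** Isometry gives J G J^T = G for the metric matrix G; putting this for G in J G makes J^2 = -1
    appear. Thus J can be moved to the other argument of g at the cost of a sign. *)
Lemma kaehler_formE k p : cdom M k p ->
  kaehler_form k p = - (cstruct M k p *m metric M k p).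
Proof.
move=> kp; have JGJ : cstruct M k p *m metric M k p *m (cstruct M k p)^T = metric M k p.
  apply: gdot_inj => u v; rewrite -(cstruct_isometry kp u v) /gdot.
  by rewrite trmx_mul !mulmxA.
by rewrite /kaehler_form -{2}JGJ !mulmxA cstruct_sq// !mulNmx mul1mx opprK.
Qed.

Lemma kaehler_form_anti k p : cdom M k p ->
  (kaehler_form k p)^T = - kaehler_form k p.
Proof.
move=> kp; rewrite [in RHS]kaehler_formE// opprK /kaehler_form trmx_mul trmxK.
by rewrite Defs.metric_sym.
Qed.

Lemma differentiable_chart (W : normedModType R) (h : atlas M -> M -> W) k p :
  smooth_family h -> cdom M k p -> differentiable (h k \o cinv M k) (cmap M k p).
Proof. by move=> sh kp; apply: (smooth_on_differentiable (sh k)); exists p. Qed.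

Lemma differentiable_kaehler_form k p : cdom M k p ->
  differentiable (kaehler_form k \o cinv M k) (cmap M k p).
Proof.
move=> kp; apply: (@differentiable_mulmx _ _ _ _ _ (metric M k \o cinv M k)
  (fun y => ((cstruct M k \o cinv M k) y)^T)).
  exact: differentiable_chart (@metric_smooth _ _ M) kp.
apply: differentiable_trmx; exact: differentiable_chart (@cstruct_smooth _ _ M) kp.
Qed.

(** The Leibniz rule combines the covariant constancy of the metric and of J; the two terms with G
    Gam^T J^T cancel. The result is in the form that [pullback_closed] requires. *)
Lemma kaehler_form_parallel k p c : cdom M k p ->
  'D_(delta_mx 0 c) (kaehler_form k \o cinv M k) (cmap M k p) =
  lc_connection k p c *m kaehler_form k p +
  kaehler_form k p *m (lc_connection k p c)^T.
Proof.
move=> kp.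
have dG := differentiable_chart (@metric_smooth _ _ M) kp.
have dJ := differentiable_chart (@cstruct_smooth _ _ M) kp.
have dJt := differentiable_trmx dJ.
have [_ _ mG] := lc_connectionP M.
have DG := mG k p c kp.
have /eqP := cstruct_parallel c kp; rewrite subr_eq0 eq_sym -subr_eq => /eqP DJ.
rewrite (derive_mulmx _ dG dJt) derive_trmx// -/(cpartial _ _ _ _) -/(cpartial _ _ _ _).
rewrite DG -DJ /kaehler_form /= cmapK// linearB /= !trmx_mul !(mulmxDl, mulmxDr).
by rewrite mulmxN !mulmxA -addrA [X in _ + X]addrC subrK.
Qed.

End KaehlerForm.

(** * The pulled back Kaehler form on the warped product and its fibre components *)

Section WarpedKaehler.
Context {R : realType} {n b t : nat}.
Variables (M : kaehlerManifold R n) (B : riemannianManifold R b).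
Variables (F : riemannianManifold R t) (f : warping_function B).
Variable phi : warped_product F f -> M.
Hypothesis phi_iso : isometric_immersion phi.
Hypothesis phi_holo : forall p : B, holomorphic_submanifold (fun q : F => phi (p, q)).

Section Charts.
Variables (i : atlas B) (j : atlas F) (k : atlas M).

Let P := warped_product F f.
Let ij : atlas P := (i, j).
Let U := cmap P ij @` (cdom P ij `&` phi @^-1` cdom M k).
Let Phi := cmap M k \o phi \o cinv P ij.
Let Om := kaehler_form k \o cinv M k.

Lemma local_domain_open : open U.
Proof.
apply: overlap_open; apply: open_comp; last exact: cdom_open.
by move=> x _; exact: phi_iso.1.1.1.
Qed.

Lemma local_repr_smooth : smooth_on U Phi.
Proof. exact: phi_iso.1.1.2. Qed.

Lemma local_domainP x : U x -> [/\ cdom P ij (cinv P ij x), cdom M k (phi (cinv P ij x))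
  & cmap P ij (cinv P ij x) = x].
Proof. by move=> [p [ijp kp] <-]; rewrite cmapK. Qed.

Lemma derive_local_repr v x : U x -> 'D_v Phi x = v *m dmap ij k phi (cinv P ij x).
Proof.
move=> Ux; have [_ _ E] := local_domainP Ux.
by rewrite deriveEjacobian ?/dmap ?E//; exact: smooth_on_differentiable local_repr_smooth Ux.
Qed.

(** Along [row_mx 0 v] only the fibre coordinates move, so the tangent space of the fibre is spanned
    by the lower rows of the differential of [phi]. *)
Lemma dmap_slice p q : cdom B i p -> cdom F j q -> cdom M k (phi (p, q)) ->
  dmap j k (fun q => phi (p, q)) q = dsubmx (dmap ij k phi (p, q) : 'M[R]_(b + t, n)).
Proof.
move=> ip jq kpq; set D := dmap ij _ _ _.
apply/row_matrixP => a; rewrite !rowE; move: (delta_mx 0 a) => v.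
have Ux : U (cmap P ij (p, q)) by exists (p, q).
have -> : v *m dsubmx D = row_mx 0 v *m (D : 'M[R]_(b + t, n)).
  by rewrite -[D in RHS]vsubmxK mul_row_col mul0mx add0r.
have := derive_local_repr (row_mx 0 v) Ux; rewrite cmapK// => <-.
rewrite -deriveEjacobian; last first.
  have [[_ sm] _] := (phi_holo p).1.
  by apply: smooth_on_differentiable (sm j k) _; exists q.
apply: derive_eq_line => h.
rewrite /Phi /= /prod_cinv /prod_cmap /= scale_row_mx add_row_mx scaler0 add0r.
by rewrite row_mxKl row_mxKr cmapK.
Qed.

(** The first two relations are blocks of the isometry equation for the warped metric; [S] is the
    matrix of J on the fibre and exists by holomorphy. *)
Lemma jacobian_relations p q : cdom B i p -> cdom F j q -> cdom M k (phi (p, q)) ->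
  let D := dmap ij k phi (p, q) : 'M[R]_(b + t, n) in
  let G := metric M k (phi (p, q)) in
  [/\ usubmx D *m G *m (dsubmx D)^T = 0,
      dsubmx D *m G *m (dsubmx D)^T = f p ^+ 2 *: metric F j q
    & exists2 S : 'M[R]_t, dsubmx D *m cstruct M k (phi (p, q)) = S *m dsubmx D &
        S *m S = - 1%:M].
Proof.
move=> ip jq kpq D G.
have := phi_iso.2 ij k (p, q) (conj ip jq) kpq.
rewrite -/D -/G -[D in LHS]vsubmxK tr_col_mx mul_col_mx mul_col_row.
rewrite /= /warped_metric /= => /eq_block_mx[_ E1 _ E2]; split=> //.
have [[_ rf] st] := phi_holo p.
have := st j k q jq kpq; rewrite dmap_slice// -/D => /submxP[S SD].
exists S => //; have := rf j k q jq kpq; rewrite dmap_slice// -/D => rfD.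
(* [S *m S] is determined after multiplication by the lower block, which is injective because the
   slice is an immersion. *)
apply: (row_free_inj rfD) => /=; rewrite -mulmxA -SD mulmxA -SD -mulmxA cstruct_sq//.
by rewrite mulmxN mulmx1 mulNmx mul1mx.
Qed.

(** These are the components of the pulled back form on coordinate-constant fields; such fields
    commute, so its exterior derivative is a cyclic sum of derivatives without bracket terms. *)
Let pull (v w : 'rV[R]_(b + t)) x := 'D_v Phi x *m Om (Phi x) *m ('D_w Phi x)^T.

Lemma pullE v w x : U x -> let D := dmap ij k phi (cinv P ij x) in
  pull v w x = v *m (D *m kaehler_form k (phi (cinv P ij x)) *m D^T) *m w^T.
Proof.
move=> Ux D; have [_ kx _] := local_domainP Ux.
by rewrite /pull !derive_local_repr// -/D /Om /Phi /= cmapK// trmx_mul !mulmxA.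
Qed.

(** Placing J on the fibre vector, in either order of the arguments, keeps that vector tangent to
    the fibre, hence orthogonal to the base. *)
Lemma pull_mixed u v x : U x ->
  pull (row_mx u 0) (row_mx 0 v) x = 0 /\ pull (row_mx 0 v) (row_mx u 0) x = 0.
Proof.
move=> Ux; rewrite !pullE//; have [ijx kx _] := local_domainP Ux.
case: (cinv P ij x) ijx kx => p q [/= ip jq] kpq.
have [E1 _ [S SE _]] := jacobian_relations ip jq kpq.
set D := dmap _ _ _ _ in E1 SE *; set G := metric _ _ _ in E1.
rewrite -[D]vsubmxK tr_col_mx mul_col_mx mul_col_row !tr_row_mx !mul_row_block.
rewrite !trmx0 !mul_row_col !mulmx0 !mul0mx !addr0 !add0r; split.
  suff -> : usubmx D *m kaehler_form k (phi (p, q)) *m (dsubmx D)^T = 0.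
    by rewrite mulmx0 mul0mx.
  by rewrite /kaehler_form -!mulmxA -trmx_mul SE trmx_mul !mulmxA E1 mul0mx.
suff -> : dsubmx D *m kaehler_form k (phi (p, q)) *m (usubmx D)^T = 0.
  by rewrite mulmx0 mul0mx.
rewrite kaehler_formE// mulmxN mulNmx mulmxA SE -!mulmxA.
have : (usubmx D *m G *m (dsubmx D)^T)^T = 0 by rewrite E1 trmx0.
by rewrite !trmx_mul trmxK Defs.metric_sym// => ->; rewrite mulmx0 oppr0.
Qed.

(** In the cyclic sum for closedness, the other two terms differentiate mixed components, which
    vanish on the whole open set [U] and not just at [x]. *)
Lemma pull_fibre_base_derivative u v w x : U x ->
  'D_(row_mx u 0) (pull (row_mx 0 v) (row_mx 0 w)) x = 0.
Proof.
move=> Ux; have [_ kx _] := local_domainP Ux.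
have [_ tf _] := lc_connectionP M.
have OmE : Om (Phi x) = kaehler_form k (phi (cinv P ij x)) by rewrite /Om /Phi /= cmapK.
have C : 'D_(row_mx u 0) (pull (row_mx 0 v) (row_mx 0 w)) x +
    'D_(row_mx 0 v) (pull (row_mx 0 w) (row_mx u 0)) x +
    'D_(row_mx 0 w) (pull (row_mx u 0) (row_mx 0 v)) x = 0.
  apply: (@pullback_closed R _ n U Phi Om (lc_connection k (phi (cinv P ij x))) x _ _ _
    local_domain_open local_repr_smooth Ux).
  - exact: differentiable_kaehler_form.
  - by move=> c; apply: etrans (kaehler_form_parallel c kx) _; rewrite OmE.
  - by move=> a c d; exact: tf.
  - by rewrite OmE; exact: kaehler_form_anti.
have D0 (g : 'rV[R]_(b + t) -> 'M[R]_1) s : (forall y, U y -> g y = 0) -> 'D_s g x = 0.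
  move=> g0; rewrite -(derive_cst (0 : 'M[R]_1) x s); apply: near_eq_derive.
  by apply: filterS (open_nbhs_nbhs (conj local_domain_open Ux)) => y /g0.
have e1 := D0 _ (row_mx 0 v) (fun y Uy => (pull_mixed u w Uy).2).
have e2 := D0 _ (row_mx 0 w) (fun y Uy => (pull_mixed u v Uy).1).
apply: etrans C; apply: esym.
apply: etrans (congr2 +%R (congr2 +%R erefl e1) e2) _.
exact: etrans (addr0 _) (addr0 _).
Qed.

Lemma pull_differentiable v w x : U x -> differentiable (pull v w) x.
Proof.
move=> Ux; have [_ kx _] := local_domainP Ux.
have d s : differentiable ('D_s Phi) x :=
  smooth_on_differentiable (smooth_on_derive s local_repr_smooth) Ux.
apply: (@differentiable_mulmx _ _ _ _ _ (fun y => 'D_v Phi y *m Om (Phi y))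
  (fun y => ('D_w Phi y)^T)); last exact: differentiable_trmx.
apply: (@differentiable_mulmx _ _ _ _ _ ('D_v Phi) (Om \o Phi)) => //.
apply: differentiable_comp; first exact: smooth_on_differentiable local_repr_smooth Ux.
exact: differentiable_kaehler_form.
Qed.

Let fibre_form p q : 'M[R]_t :=
  dsubmx (dmap ij k phi (p, q) : 'M[R]_(b + t, n)) *m kaehler_form k (phi (p, q)) *m
  (dsubmx (dmap ij k phi (p, q) : 'M[R]_(b + t, n)))^T.

(** Squaring eliminates [\det S], which may vary with [p]: its square is the determinant of
    [S *m S], that is of minus the identity. *)
Lemma fibre_form_det p q : cdom B i p -> cdom F j q -> cdom M k (phi (p, q)) ->
  \det (fibre_form p q) ^+ 2 = f p ^+ (4 * t) * (\det (metric F j q) ^+ 2 * (-1) ^+ t).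
Proof.
move=> ip jq kpq; have [_ E [S SE SS]] := jacobian_relations ip jq kpq.
rewrite /fibre_form /kaehler_form -!mulmxA -trmx_mul SE trmx_mul !mulmxA E.
rewrite -scalemxAl detZ det_mulmx det_tr.
have E2 : \det S ^+ 2 = (-1) ^+ t.
  by rewrite expr2 -det_mulmx SS -scaleN1r detZ det1 mulr1.
rewrite -E2; move: (\det _) (\det S) => x y; rewrite -exprM !(exprMn 2) -exprM.
by congr (_ ^+ _ * _); lia.
Qed.

(** The segment between the two base points stays in a convex chart ball, and each fibre component
    has zero derivative along it. *)
Lemma fibre_form_base_constant p q r (p' : B) : cdom B i p -> cdom F j q -> cdom B i p' ->
  cdom M k (phi (p', q)) ->
  ball (cmap B i p) r (cmap B i p') ->
  (forall a, ball (cmap B i p) r a -> U (row_mx a (cmap F j q))) ->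
  fibre_form p' q = fibre_form p q.
Proof.
move=> ip jq ip' kp' rp' rU.
set a := cmap B i p in rp' rU *; set y := cmap F j q in rU *; set u := cmap B i p' - a.
have ur : `|u| < r by move: rp'; rewrite -ball_normE /ball_/= distrC.
have r0 : 0 < r by exact: le_lt_trans ur.
have Us (s : R) : 0 <= s <= 1 -> U (row_mx a y + s *: row_mx u 0).
  move=> /andP[s0 s1]; rewrite scale_row_mx add_row_mx scaler0 addr0; apply: rU.
  rewrite -ball_normE /ball_/= opprD addrA subrr sub0r normrN normrZ ger0_norm//.
  by apply: le_lt_trans ur; rewrite ler_piMl.
apply/matrixP => c d.
have E p1 : cdom B i p1 -> U (row_mx (cmap B i p1) y) -> fibre_form p1 q c d =
    pull (row_mx 0 (delta_mx 0 c)) (row_mx 0 (delta_mx 0 d)) (row_mx (cmap B i p1) y) 0 0.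
  move=> ip1 Up1; rewrite pullE//.
  have -> : cinv P ij (row_mx (cmap B i p1) y) = (p1, q).
    by rewrite /= /prod_cinv /= row_mxKl row_mxKr !cmapK.
  set D := dmap _ _ _ _; rewrite /fibre_form -/D.
  rewrite -[D in RHS]vsubmxK tr_col_mx mul_col_mx mul_col_row !tr_row_mx !mul_row_block.
  rewrite !trmx0 !mul_row_col !mulmx0 !mul0mx !add0r.
  by rewrite trmx_delta -colE -rowE !mxE.
have Ua : U (row_mx a y) by apply: rU; exact: ballxx.
have Ua' : U (row_mx (cmap B i p') y) by exact: rU.
apply: etrans (E p' ip' Ua') (etrans _ (esym (E p ip Ua))).
pose g x := pull (row_mx 0 (delta_mx 0 c)) (row_mx 0 (delta_mx 0 d)) x 0 0.
have rE : row_mx (cmap B i p') y = row_mx a y + row_mx u 0.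
  by rewrite add_row_mx addr0 /u addrC subrK.
apply: etrans (congr1 g rE) _; apply: derive0_constant_line => s /Us Us'.
have dp := pull_differentiable (row_mx 0 (delta_mx 0 c)) (row_mx 0 (delta_mx 0 d)) Us'.
split; first exact: differentiable_coord_mx.
apply: etrans (derive_coord _ 0 0 dp) _.
by rewrite pull_fibre_base_derivative// mxE.
Qed.

End Charts.

(** With [q] fixed, the squared determinants at [p'] and [p] agree and share a nonzero fibre factor;
    cancelling it equates the powers of [f], whose exponent [4 * t] is positive. *)
Lemma warping_locally_constant (p : B) (q : F) :
  (0 < t)%N -> \forall p' \near p, f p' = f p.
Proof.
move=> t0; have [i ip] := cdom_cover p; have [j jq] := cdom_cover q.
have [k kpq] := cdom_cover (phi (p, q)).
pose P := warped_product F f; pose ij : atlas P := (i, j).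
set U := cmap P ij @` (cdom P ij `&` phi @^-1` cdom M k).
have Upq : U (row_mx (cmap B i p) (cmap F j q)) by exists (p, q).
have nU : nbhs (row_mx (cmap B i p) (cmap F j q)) U.
  by apply: open_nbhs_nbhs; split=> //; exact: local_domain_open.
(* Freezing the fibre coordinates is continuous in the base coordinates, which gives a base ball
   whose points all land in [U]. *)
have cU : (fun a => row_mx a (cmap F j q)) @ cmap B i p --> row_mx (cmap B i p) (cmap F j q).
  apply: (@row_mx_cvg R b t _ (nbhs (cmap B i p)) _ id (fun=> cmap F j q)) => //.
  exact: cvg_cst.
have rU : nbhs (cmap B i p) [set a | U (row_mx a (cmap F j q))] by exact: cU _ nU.
have [r /= r0 Hr] := (nbhs_ballP _ _).1 rU.
have n1 : nbhs p (cdom B i) by apply: open_nbhs_nbhs; split=> //; exact: cdom_open.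
have n2 : nbhs p (cmap B i @^-1` ball (cmap B i p) r).
  by apply: (cmap_continuous ip); exact: nbhsx_ballx.
apply: filterS2 n1 n2 => p' ip' bp'.
have [_ kp'q _] := local_domainP (Hr _ bp').
rewrite /= /prod_cinv /= row_mxKl row_mxKr !cmapK// in kp'q.
have E := fibre_form_base_constant ip jq ip' kp'q bp' Hr.
have := fibre_form_det ip' jq kp'q; rewrite E (fibre_form_det ip jq kpq).
have nz : \det (metric F j q) ^+ 2 * (-1) ^+ t != 0.
  apply: mulf_neq0; last by rewrite signr_eq0.
  by apply: expf_neq0; apply: posdef_det_neq0; exact: metric_pos jq.
have f_nneg x : f x \is Num.nneg by rewrite nnegrE ltW ?wfun_gt0.
have t4 : (0 < 4 * t)%N by rewrite muln_gt0.
by move=> /(mulIf nz) fX; exact: (@pexpIrn R _ t4 _ _ (f_nneg p') (f_nneg p) (esym fX)).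
Qed.

End WarpedKaehler.

(** * From local to global constancy over a connected base *)

Lemma connected_locally_constant (T : topologicalType) (W : Type) (f : T -> W) :
  connected [set: T] -> (forall x, \forall y \near x, f y = f x) ->
  forall x y, f x = f y.
Proof.
move=> cT lc x y.
pose A := [set z | f z = f x].
have oA : open A by rewrite openE => z Az; apply: filterS (lc z) => w wz; exact: etrans wz Az.
(* Near a limit point [z] of the level set, [f] is constantly [f z], and this neighbourhood meets
   the level set. *)
have cA : closed A.
  by move=> z cz; have [w [Aw wz]] := cz _ (lc z); exact: etrans (esym wz) Aw.
suff AT : A = setT by have : A y by [rewrite AT]; exact: esym.
apply: cT; first by exists x.
  by exists A; rewrite // setTI.
by exists A; rewrite // setTI.
Qed.

Theorem theorem4p1 (R : realType) (n : nat) (Mbar : kaehlerManifold R n) :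
  ~ exists (b t : nat) (Mtheta : riemannianManifold R b)
      (MT : riemannianManifold R t) (f : warping_function Mtheta)
      (phi : warped_product MT f -> Mbar),
    [/\ connected [set: Mtheta], [set: MT] !=set0 & (0 < t)%N] /\
    [/\ isometric_immersion phi,
        forall p : Mtheta, holomorphic_submanifold (fun q : MT => phi (p, q)),
        forall q : MT,
          proper_pointwise_slant_submanifold (fun p : Mtheta => phi (p, q))
      & ~ trivial_warping f].
Proof.
move=> [b [t [B [F [f [phi [[cB [q _] t0] [phi_iso phi_holo _ nontriv]]]]]]]].
apply: nontriv.
have lc p := warping_locally_constant phi_iso phi_holo p q t0.
have [[p _]|B0] := pselect ([set: B] !=set0).
  by exists (f p) => p'; exact: connected_locally_constant cB lc p' p.
(* Over an empty base any constant serves; 0 is arbitrary. *)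
by exists 0 => p; case: B0; exists p.
Qed.
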